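(* For positive integers $n$ and $r$, let $s=(2r,3r,\ldots,nr)$ and $\mu=(r,2r,\ldots,nr)$. Then \[ d_{n-1}^s(z)+d_n^\mu(z)=d_{n,r}(z). \]
   Context: For a sequence $t=(t_1,\ldots,t_m)$ of positive integers, $P_m^t=\{x\in\mathbb{R}^m:0\le x_1/t_1\le\cdots\le x_m/t_m\le1\}$ (for $m=0$ a point) and $d_m^t(z)=\ell^\ast(P_m^t;z)$, where for a lattice $d$-simplex $\Delta=\mathrm{conv}(v^{(0)},\ldots,v^{(d)})\subset\mathbb{R}^m$, $\ell^\ast(\Delta;z)=\sum_{x\in\Pi^\circ_\Delta\cap\mathbb{Z}^{m+1}}z^{x_{m+1}}$, $\Pi^\circ_\Delta=\{\sum_i\lambda_i(v^{(i)},1):0<\lambda_i<1\}$. An $r$-colored permutation is $(\pi,c)$ with $\pi\in\mathfrak{S}_n$, $c\in\{0,\ldots,r-1\}^n$. An index $i$ is an excedance if $\pi_i>i$, or $\pi_i=i$ and $c_i>0$. A derangement is one with no fixed point of color $0$; $d_{n,r}(z)=\sum_{\sigma}z^{\mathrm{exc}(\sigma)}$ over all $r$-colored derangements of length $n$. *)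

(* Defs.v *)
From HB Require Import structures.
From mathcomp Require Import all_boot all_order all_algebra all_fingroup.
From mathcomp Require Import boolp Rstruct.
From Stdlib Require Rdefinitions.
Set Implicit Arguments. Unset Strict Implicit. Unset Printing Implicit Defensive.
Import Order.TTheory GRing.Theory Num.Theory.
Local Open Scope ring_scope.

Fixpoint int_box (B k : nat) : seq (seq int) :=
  match k with
  | 0 => [:: [::]]
  | k'.+1 => [seq a :: s | a <- [seq (i%:Z - B%:Z) | i <- iota 0 (B + B).+1],
                           s <- int_box B k']
  end.

(* x (a point of Z^(m+1), as a sequence of length m+1) lies in the open
   fundamental parallelepiped  { sum_i lambda_i (v^(i),1) : 0 < lambda_i < 1 }
   of the lattice simplex with vertex list V (each vertex in Z^m). *)
Definition in_open_par (m : nat) (V : seq (seq int)) (x : seq int) : Prop :=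
  exists lam : nat -> Rdefinitions.R,
    (forall i, (i < size V)%N -> 0 < lam i /\ lam i < 1) /\
    (forall j, (j < m.+1)%N ->
       ((nth 0 x j)%:~R : Rdefinitions.R) =
       \sum_(i < size V) lam i * (nth 0 (rcons (nth [::] V i) 1) j)%:~R).

Definition par_bound (V : seq (seq int)) : nat :=
  (\sum_(v <- V) \sum_(c <- v) `|c|%N + size V)%N.

(* l^*(Delta; z) = sum over x in Pi^o cap Z^(m+1) of z^(x_(m+1)).
   The sum ranges over a finite box that contains every such lattice point. *)
Definition ellstar (m : nat) (V : seq (seq int)) : {poly int} :=
  \sum_(x <- int_box (par_bound V) m.+1 | `[< in_open_par m V x >])
     'X^(`|nth (0:int) x m|%N).

(* Vertices of P_m^t = { 0 <= x_1/t_1 <= ... <= x_m/t_m <= 1 }, m = size t: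
   v^(k) has coordinates x_i = t_i for i > m - k and 0 otherwise (k = 0..m). *)
Definition Pverts (t : seq nat) : seq (seq int) :=
  [seq [seq (if (size t - k <= i)%N then (nth 0 t i)%:Z else 0)
          | i <- iota 0 (size t)] | k <- iota 0 (size t).+1].

Definition dmt (t : seq nat) : {poly int} := ellstar (size t) (Pverts t).

Definition is_exc (n r : nat) (p : 'S_n) (c : {ffun 'I_n -> 'I_r}) (i : 'I_n) : bool :=
  (i < p i)%N || ((p i == i) && (0 < c i)%N).

Definition exc (n r : nat) (p : 'S_n) (c : {ffun 'I_n -> 'I_r}) : nat :=
  #|[set i | is_exc p c i]|.

Definition is_derangement (n r : nat) (p : 'S_n) (c : {ffun 'I_n -> 'I_r}) : bool :=
  [forall i, ~~ ((p i == i) && (c i == 0%N :> nat))].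

Definition dnr (n r : nat) : {poly int} :=
  \sum_(p : 'S_n) \sum_(c : {ffun 'I_n -> 'I_r} | is_derangement p c) 'X^(exc p c).

(* Main.v *)
Require Import Defs.
From mathcomp Require Import all_boot all_order all_algebra all_fingroup.
From mathcomp Require Import zify ring boolp Rstruct.
From Stdlib Require Rdefinitions.
Set Implicit Arguments. Unset Strict Implicit. Unset Printing Implicit Defensive.
Import Order.TTheory GRing.Theory Num.Theory.
Local Open Scope ring_scope.

(** Both sides are computed as sum_j (-1)^j C(n,j) A_(n-j)(z), where A_m(z) =
    (1-z)^(m+1) sum_t (rt+1)^m z^t is the colored Eulerian polynomial.

    Permutations: summing over the colors turns d_(n,r) into the permanent of the matrix
    with (r-1)z on the diagonal, rz above and r below.  The permanent with 1 + (r-1)z on the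
    diagonal is A_n (inserting the largest letter into a permutation gives its recurrence),
    and the two are related by a Taylor expansion in the diagonal entry, since the derivative
    of the n-th permanent in that entry is n times the previous one.

    Polytopes: a lattice point of the open parallelepiped is a chain of integers x_i with
    0 < x_(i+1)/t_(i+1) - x_i/t_i < 1 (starting at x_0/t_0 = 0, with t_(m+1) = 1).  For
    t_i = ir, the points counted by s are the chains starting at x_1 = 0, so s and mu together
    count the chains with 0 <= x_1 < r.  The window of admissible x_i is a difference of two
    prefix sums, minus the value at the point x_i/i = x_(i+1)/(i+1).  Marking these
    equalities by a variable y, the prefix sums have a closed product form, and the
    differences, which commute with everything else, can be taken at the end. *)

(** * Excedances as permanents *)

Section WeightedPermutations.

Variable R : comNzRingType.
Implicit Types a b c : R.

Definition exc_weight a b c (i j : nat) : R :=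
  if (i < j)%N then b else if i == j then a else c.

Definition exc_sum (n : nat) a b c : R :=
  \sum_(p : 'S_n) \prod_(i < n) exc_weight a b c i (p i).

Lemma exc_weight_bump a b c h i j :
  exc_weight a b c (bump h i) (bump h j) = exc_weight a b c i j.
Proof.
have ltnE : (bump h i < bump h j)%N = (i < j)%N by rewrite /bump; lia.
have eqE : (bump h i == bump h j) = (i == j) by rewrite /bump; lia.
by rewrite /exc_weight ltnE eqE.
Qed.

Lemma sum_perm_lift n (i j : 'I_n.+1) (F : 'S_n.+1 -> R) :
  \sum_(p : 'S_n.+1 | p i == j) F p = \sum_(s : 'S_n) F (lift_perm i j s).
Proof.
(* [f p] deletes [i] from the domain and [p i] from the range. The default of [odflt] is never
   reached, since [p (lift i k)] differs from [p i]. *)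
pose f (p : 'S_n.+1) k := odflt k (unlift (p i) (p (lift i k))).
have fE (p : 'S_n.+1) k : lift (p i) (f p k) = p (lift i k).
  have /unlift_some[l pl ul] : p i != p (lift i k) by rewrite (inj_eq perm_inj) neq_lift.
  by rewrite /f ul -pl.
have f_inj (p : 'S_n.+1) : injective (f p).
  move=> k l /(congr1 (lift (p i))); rewrite !fE => /perm_inj.
  exact: lift_inj.
rewrite (reindex_onto (lift_perm i j) (fun p => perm (f_inj p))) /=.
  apply: eq_bigl => s; rewrite lift_perm_id eqxx /=.
  apply/eqP/permP => k; rewrite permE; apply: (@lift_inj _ j).
  by rewrite -[X in lift X _ = _](lift_perm_id i j s) fE lift_perm_lift.
move=> p /eqP pij; apply/permP => k.
by case: (unliftP i k) => [l|] ->; rewrite ?lift_perm_id // lift_perm_lift permE -pij fE.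
Qed.

Lemma prod_ord_lift n (i : 'I_n.+1) (F : 'I_n.+1 -> R) :
  \prod_(k | k != i) F k = \prod_(k < n) F (lift i k).
Proof.
rewrite (reindex_omap (lift i) (unlift i)) /= => [|k].
  by apply: eq_bigl => k; rewrite liftK eqxx andbT eq_sym neq_lift.
by case: unliftP => [l ->|->] //; rewrite eqxx.
Qed.

(** Deleting a fixed point keeps the relative order of the other letters, hence all their
    weights. *)
Lemma exc_sum_fixing n a b c (i : 'I_n.+1) :
  \sum_(p : 'S_n.+1 | p i == i) \prod_(k | k != i) exc_weight a b c k (p k)
  = exc_sum n a b c.
Proof.
rewrite sum_perm_lift; apply: eq_bigr => s _; rewrite prod_ord_lift.
by apply: eq_bigr => k _; rewrite lift_perm_lift exc_weight_bump.
Qed.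

(* A permutation not fixing the largest letter m is obtained from a smaller one s by inserting
   m after some i, i.e. by replacing i -> s i with i -> m -> s i. *)
Lemma exc_sumS n a b c :
  exc_sum n.+1 a b c = a * exc_sum n a b c +
  \sum_(s : 'S_n) \sum_(i < n) b * c * \prod_(k | k != i) exc_weight a b c k (s k).
Proof.
pose m : 'I_n.+1 := ord_max.
rewrite {1}/exc_sum (partition_big (fun p : 'S_n.+1 => (p^-1)%g m) predT) //=.
rewrite (bigD1_ord m) //=; congr (_ + _).
  rewrite -(exc_sum_fixing _ _ _ m) big_distrr; apply: eq_big => [p|p /eqP].
    by rewrite -(inj_eq (@perm_inj _ p)) permKV eq_sym.
  move=> /(congr1 p); rewrite permKV => pm.
  by rewrite (bigD1 m) //= -pm /exc_weight ltnn eqxx.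
rewrite exchange_big; apply: eq_bigr => i _ /=.
(* Composing with the transposition of [i] and [m] turns [p i = m] into the condition that [m] is
   fixed. Undoing it later, [i -> m] has weight [b] and [m -> s i] has weight [c]. *)
rewrite (eq_bigl (fun p : 'S_n.+1 => (tperm (lift m i) m * p)%g m == m)); last first.
  move=> p; rewrite permM tpermR -(inj_eq (@perm_inj _ p)) permKV.
  by rewrite eq_sym.
rewrite (reindex_inj (mulgI (tperm (lift m i) m))) /=.
under eq_bigl do rewrite mulgA tperm2 mul1g.
rewrite sum_perm_lift; apply: eq_bigr => s _.
rewrite (bigD1_ord m) //= permM tpermR lift_perm_lift.
rewrite (bigD1 i) //= permM tpermL lift_perm_id.
rewrite mulrCA mulrA; congr (_ * _).
  have [bi bs] : bump n i = i /\ bump n (s i) = s i.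
    by rewrite /bump; have := ltn_ord i; have := ltn_ord (s i); lia.
  rewrite /exc_weight /= bi bs ltn_ord.
  by rewrite ltnNge ltnW // gtn_eqF.
apply: eq_bigr => k ki; rewrite permM tpermD ?neq_lift //.
  by rewrite lift_perm_lift exc_weight_bump.
by rewrite (inj_eq (@lift_inj _ m)) eq_sym.
Qed.

End WeightedPermutations.

Lemma deriv_prod (R : comNzRingType) (I : finType) (F : I -> {poly R}) :
  (\prod_i F i)^`() = \sum_i (F i)^`() * \prod_(k | k != i) F k.
Proof.
have key (r : seq I) : uniq r ->
  (\prod_(i <- r) F i)^`() = \sum_(i <- r) (F i)^`() * \prod_(k <- r | k != i) F k.
  elim: r => [|x r IH] /=; first by rewrite !big_nil derivC.
  case/andP=> xr ur; rewrite !big_cons eqxx /= derivM IH //; congr (_ * _ + _).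
    rewrite big_seq [RHS]big_seq_cond; apply: eq_bigl => k.
    by case: eqP => [->|]; rewrite ?(negPf xr) // andbT.
  rewrite big_distrr big_seq [RHS]big_seq; apply: eq_bigr => k kr /=.
  have xk : x != k by apply: contraNneq xr => ->.
  by rewrite big_cons xk mulrCA.
by rewrite key ?index_enum_uniq.
Qed.

(** All three weights solve the same equation [r z (1 - z) w' + r z w = r^2 z], whose right side is
    the factor [b c] created by an insertion. The Leibniz rule therefore turns the sum over
    insertion places into a derivative of the whole product. *)
Lemma exc_sum_recurrence (r n : nat) :
  let P m := exc_sum m (1 + (r%:R - 1) * 'X) (r%:R * 'X) r%:R : {poly int} in
  P n.+1 = (1 + (r%:R * n.+1%:R - 1) * 'X) * P n + r%:R * 'X * (1 - 'X) * (P n)^`().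
Proof.
move=> P; rewrite {1}/P exc_sumS -/(P n).
set w := exc_weight _ _ _; set bc := _ * 'X * r%:R.
have wE (i j : nat) : bc = r%:R * 'X * (1 - 'X) * (w i j)^`() + r%:R * 'X * w i j.
  rewrite /w /exc_weight /bc; case: ifP => _; last case: ifP => _;
  rewrite !(derivD, derivM, derivB, derivN, derivX, derivC, derivMn); ring.
have sE (s : 'S_n) : \sum_(i < n) bc * \prod_(k < n | k != i) w k (s k) =
    r%:R * 'X * (1 - 'X) * (\prod_(i < n) w i (s i))^`() + n%:R * (r%:R * 'X * \prod_(i < n) w i (s i)).
  have nE (x : {poly int}) : n%:R * x = \sum_(i < n) x by rewrite sumr_const card_ord mulr_natl.
  rewrite nE deriv_prod big_distrr -big_split /=.
  apply: eq_bigr => i _; by rewrite (wE i (s i)) mulrDl [X in _ = _ + _ * X](bigD1 i) //= -!mulrA.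
rewrite (eq_bigr _ (fun s _ => sE s)) big_split /= -!big_distrr /= -(raddf_sum (@deriv _)).
rewrite -/(exc_sum _ _ _ _) -/(P n) mulrS; ring.
Qed.

(** Differentiating the factor at [i] leaves only the permutations that fix [i]. Deleting [i] then
    gives the same smaller sum for each of the [n + 1] choices. *)
Lemma exc_sum_deriv (R : comNzRingType) n (a b c : R) :
  (exc_sum n.+1 ('X + a%:P) b%:P c%:P)^`() = exc_sum n ('X + a%:P) b%:P c%:P *+ n.+1.
Proof.
rewrite /exc_sum raddf_sum -/(exc_sum n _ _ _) /=.
under eq_bigr do rewrite deriv_prod.
have nE (x : {poly R}) : x *+ n.+1 = \sum_(i < n.+1) x by rewrite sumr_const card_ord.
rewrite exchange_big nE /=.
apply: eq_bigr => i _; rewrite -(exc_sum_fixing _ _ _ i) [RHS]big_mkcond /=.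
apply: eq_bigr => p _; rewrite {1}/exc_weight (inj_eq val_inj) [i == _]eq_sym.
case: ltngtP => [ip|pi|/val_inj ip]; last 1 first.
- by rewrite -ip eqxx derivD derivX derivC addr0 mul1r.
- by rewrite (negPf (_ : p i != i)) ?derivC ?mul0r // -(inj_eq val_inj) /= gtn_eqF.
- by rewrite (negPf (_ : p i != i)) ?derivC ?mul0r // -(inj_eq val_inj) /= ltn_eqF.
Qed.

Lemma size_exc_sum (R : comNzRingType) n (a b c : R) :
  (size (exc_sum n ('X + a%:P) b%:P c%:P) <= n.+1)%N.
Proof.
apply: (leq_trans (size_sum _ _ _)); apply/bigmax_leqP => p _.
apply: (leq_trans (size_poly_prod_leq _ _)); rewrite leq_subLR card_ord.
have w2 (i : 'I_n) : (size (exc_weight ('X + a%:P) b%:P c%:P i (p i)) <= 2)%N.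
  rewrite /exc_weight; case: ifP => _; last case: ifP => _; rewrite ?size_XaddC //;
  exact: leq_trans (size_polyC_leq1 _) _.
rewrite addnS ltnS; apply: (leq_trans (leq_sum _ (fun i _ => w2 i))).
by rewrite sum_nat_const card_ord; lia.
Qed.

Lemma exc_sum_rmorph (R S : comNzRingType) (f : {rmorphism R -> S}) n a b c :
  f (exc_sum n a b c) = exc_sum n (f a) (f b) (f c).
Proof.
rewrite rmorph_sum; apply: eq_bigr => p _; rewrite rmorph_prod.
by apply: eq_bigr => i _; rewrite /exc_weight !(fun_if f).
Qed.

Lemma exc_sum_shift (R : idomainType) n (a b c h : R) : [pchar R] =i pred0 ->
  exc_sum n (a + h) b c = \sum_(k < n.+1) (exc_sum (n - k) a b c * h ^+ k) *+ 'C(n, k).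
Proof.
move=> R0; pose q m := exc_sum m ('X + a%:P) b%:P c%:P.
have qE m x : (q m).[x] = exc_sum m (a + x) b c.
  rewrite -[_.[x]]/(horner_eval x (q m)) exc_sum_rmorph /= /horner_eval.
  by rewrite !hornerE addrC.
have qk k : (k <= n)%N -> (q n)^`(k) = q (n - k)%N *+ n ^_ k.
  elim: k => [|k IH] kn; first by rewrite subn0.
  rewrite derivnS IH 1?ltnW // derivMn -(subnSK kn).
  by rewrite /q exc_sum_deriv -mulrnA ffactnSr subnSK // mulnC.
rewrite -qE -[h in LHS]add0r.
rewrite (nderiv_taylor_wide (mulrC _ _) (size_exc_sum _ _ _ _)).
apply: eq_bigr => k _; have kn : (k <= n)%N by rewrite -ltnS.
rewrite -mulrnAl; congr (_ * _).
(* The Taylor coefficient is the derivative divided by [k!]; characteristic 0 allows cancelling [k!]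
   from [n^_k = 'C(n, k) k!]. *)
have fact_inj : injective (fun x : R => x *+ k`!).
  move=> x y /eqP; rewrite -subr_eq0 -mulrnBl -mulr_natr mulf_eq0.
  by rewrite ((pcharf0P R).1 R0) (gtn_eqF (fact_gt0 k)) orbF subr_eq0 => /eqP.
have := congr1 (horner^~ 0) (qk k kn).
by rewrite nderivn_def -bin_ffact mulrnA !hornerMn qE addr0 => /fact_inj.
Qed.

(** Colors at different positions are independent, so the sum over colorings factors. A position
    above the diagonal collects [r z], one below it [r], and a fixed point has [r - 1] allowed
    colors, each an excedance. *)
Lemma dnr_exc_sum n r : (0 < r)%N ->
  dnr n r = exc_sum n ((r%:R - 1) * 'X) (r%:R * 'X) r%:R.
Proof.
case: r => // r _; apply: eq_bigr => p _.
(* The value 0 at a fixed point of color 0 absorbs the derangement condition into the product. *)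
pose F (i : 'I_n) (c : 'I_r.+1) : {poly int} :=
  if (p i == i) && (c == 0%N :> nat) then 0
  else if (i < p i)%N || ((p i == i) && (0 < c)%N) then 'X else 1.
transitivity (\prod_i \sum_c F i c).
  rewrite bigA_distr_bigA big_mkcond /=; apply: eq_bigr => c _; case: ifPn.
    move=> /forallP der; rewrite /exc -prodr_const big_mkcond /=.
    by apply: eq_bigr => i _; rewrite /F (negPf (der i)) inE.
  rewrite negb_forall => /existsP[i]; rewrite negbK => fix_i.
  by rewrite (bigD1 i) //= /F fix_i mul0r.
apply: eq_bigr => i _; rewrite /F /exc_weight -(inj_eq val_inj (p i) i) /=.
case: ltngtP => _ /=.
- by rewrite sumr_const card_ord mulr_natl.
- by rewrite sumr_const card_ord.
rewrite big_ord_recl /= add0r sumr_const card_ord.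
by rewrite -natr1 addrK mulr_natl.
Qed.

(** Shifting the diagonal [1 + (r - 1) z] by -1 is inclusion-exclusion over the fixed points of
    color 0. *)
Lemma dnr_binomial n r : (0 < r)%N ->
  dnr n r = \sum_(k < n.+1)
    (exc_sum (n - k) (1 + (r%:R - 1) * 'X) (r%:R * 'X) r%:R * (-1) ^+ k) *+ 'C(n, k).
Proof.
move=> r_gt0; rewrite dnr_exc_sum // -exc_sum_shift; last first.
  by move=> p; rewrite pchar_poly pchar_num.
by congr exc_sum; ring.
Qed.

(** * Backward differences and coefficients of colored Eulerian polynomials *)

Definition bdiff (V : zmodType) (c : nat) (f : nat -> V) (N : nat) : V :=
  f N - (if (N < c)%N then 0 else f (N - c)%N).

Lemma eq_iter_bdiff (V : zmodType) c k (f g : nat -> V) :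
  f =1 g -> iter k (bdiff c) f =1 iter k (bdiff c) g.
Proof.
by move=> fg; elim: k => //= k IH N; rewrite /bdiff !IH.
Qed.

Lemma bdiff1_0 (V : zmodType) (f : nat -> V) : bdiff 1 f 0 = f 0%N.
Proof. by rewrite /bdiff subr0. Qed.

Lemma bdiff1_S (V : zmodType) (f : nat -> V) t : bdiff 1 f t.+1 = f t.+1 - f t.
Proof. by rewrite /bdiff subn1. Qed.

(** This is the Leibniz rule for differences: [r t + 1] is linear, so only two terms survive. At
    [t = 0] the shifted term is 0, because sequences are extended by 0 to negative arguments. *)
Lemma iter_bdiff1_mul (r m : nat) (g : nat -> int) t :
  iter m.+1 (bdiff 1) (fun t => (r * t + 1)%:R * g t) t =
    (r * t + 1)%:R * iter m.+1 (bdiff 1) g t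
    + (r * m.+1)%:R * (if t is t'.+1 then iter m (bdiff 1) g t' else 0).
Proof.
elim: m t => [|m IH] t.
  rewrite /=; case: t => [|t]; rewrite ?bdiff1_0 ?bdiff1_S /=; first by rewrite mulr0 addr0.
  by rewrite !natrD !natrM -natr1; ring.
rewrite iterS; case: t => [|t]; rewrite ?bdiff1_0 ?bdiff1_S !IH.
  by rewrite [in RHS]iterS bdiff1_0 !mulr0.
rewrite [iter m.+2 _ g]iterS bdiff1_S.
case: t => [|t]; rewrite ![iter m.+1 _ g]iterS ?bdiff1_0 ?bdiff1_S.
  by rewrite !natrD !natrM -natr1; ring.
by rewrite !natrD !natrM -!natr1; ring.
Qed.

(** A unit difference acts on coefficients as multiplication by [1 - z], so this is the series
    formula for [A_n]. Both sides obey the recurrence of [exc_sum_recurrence]. *)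
Lemma coef_exc_sum (r n t : nat) :
  (exc_sum n (1 + (r%:R - 1) * 'X) (r%:R * 'X) r%:R : {poly int})`_t =
  iter n.+1 (bdiff 1) (fun t => (r * t + 1)%:R ^+ n : int) t.
Proof.
elim: n t => [|n IH] t.
  rewrite /exc_sum (bigD1 1%g) //= big_ord0 big1 => [|p]; last first.
    by case/eqP; apply/permP => -[].
  by rewrite addr0 coef1; case: t => [|t]; rewrite ?bdiff1_0 ?bdiff1_S ?subrr.
have step := exc_sum_recurrence r n; rewrite /= in step; rewrite {}step.
set P := exc_sum _ _ _ _ in IH *.
rewrite (@eq_iter_bdiff _ _ _ _ (fun t => (r * t + 1)%:R * (r * t + 1)%:R ^+ n : int)) => [|u].
  2: exact: exprS.
rewrite iter_bdiff1_mul [iter n.+2 _ _]iterS.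
have -> : (1 + (r%:R * n.+1%:R - 1) * 'X) * P + r%:R * 'X * (1 - 'X) * P^`() =
  P + (r%:R * n.+1%:R - 1)%:P * (P * 'X) + r%:R%:P * (P^`() * 'X) - r%:R%:P * (P^`() * 'X * 'X).
  by rewrite polyCB polyCM !polyCMn polyC1; ring.
rewrite !(coefD, coefN, coefCM, coefMX, coef_deriv).
case: t => [|t]; rewrite ?bdiff1_0 ?bdiff1_S -?IH /=.
  by rewrite muln0 add0n; ring.
case: t => [|t] /=.
  by rewrite mulr1n !natrD !natrM -!natr1; ring.
by rewrite -[P`_t.+2 *+ _]mulr_natl -[P`_t.+1 *+ _]mulr_natl !natrD !natrM -!natr1; ring.
Qed.

(** * Chains and finite differences *)

Section Operators.

Variable V : zmodType.
Implicit Types f g : nat -> V.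

(* A weight f on the numerators M of fractions M / n is moved to the numerators N of fractions
   N / (n + 1): [cumsum] sums over M / n <= N / (n + 1), [proport] keeps M / n = N / (n + 1). *)
Definition cumsum n f N : V := \sum_(M < ((n * N) %/ n.+1).+1) f M.

Definition proport n f N : V := if (n.+1 %| N)%N then f ((n * N) %/ n.+1)%N else 0.

Lemma divn_mulB n r N : (r * n.+1 <= N)%N ->
  ((n * (N - r * n.+1)) %/ n.+1 = (n * N) %/ n.+1 - r * n)%N.
Proof.
move=> rN; by rewrite -{2}(subnK rN) mulnDr [in RHS]addnC [(n * (r * _))%N]mulnA divnMDl // [(n * r)%N]mulnC addKn.
Qed.

Lemma leq_proport n r N : (r * n <= (n * N) %/ n.+1)%N = (n == 0)%N || (r * n.+1 <= N)%N.
Proof.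
rewrite leq_divRL // mulnAC [(_ * n)%N]mulnC leq_mul2l; by case: n.
Qed.

(** Lowering [N] by [r (n + 1)] lowers the bound on [M] by exactly [r n]: both fractions drop by
    [r]. *)
Lemma bdiff_cumsum n r f : (0 < n)%N ->
  bdiff (r * n.+1) (cumsum n f) =1 cumsum n (bdiff (r * n) f).
Proof.
move=> n_gt0 N; rewrite /bdiff {3}/cumsum sumrB; congr (_ - _).
have := leq_proport n r N; rewrite (gtn_eqF n_gt0); set A := ((n * N) %/ n.+1)%N => /= rA.
case: ltnP => rN.
  have An : (A < r * n)%N by rewrite ltnNge rA -ltnNge.
  by rewrite big1 // => M _; rewrite ifT //; have := ltn_ord M; lia.
rewrite rN in rA.
rewrite /cumsum divn_mulB // -/A.
have -> : A.+1 = (r * n + (A - r * n).+1)%N by lia.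
rewrite big_split_ord /= [X in _ = X + _]big1 => [|M _]; last by rewrite ltn_ord.
by rewrite add0r; apply: eq_bigr => M _; rewrite ltnNge leq_addr addKn.
Qed.

Lemma bdiff_proport n r f : (0 < n)%N ->
  bdiff (r * n.+1) (proport n f) =1 proport n (bdiff (r * n) f).
Proof.
move=> n_gt0 N; rewrite /bdiff /proport.
rewrite [(_ %/ _ < _)%N]ltnNge leq_proport (gtn_eqF n_gt0) -ltnNge.
case: ltnP => [_|rN]; first by case: ifP; rewrite subr0.
rewrite divn_mulB // dvdn_subl ?dvdn_mull //.
by case: ifP; rewrite ?subr0.
Qed.

Lemma eq_cumsum n f g : f =1 g -> cumsum n f =1 cumsum n g.
Proof. by move=> fg N; apply: eq_bigr => M _; rewrite fg. Qed.

Lemma eq_proport n f g : f =1 g -> proport n f =1 proport n g.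
Proof. by move=> fg N; rewrite /proport fg. Qed.

Lemma eq_bdiff c f g : f =1 g -> bdiff c f =1 bdiff c g.
Proof. by move=> fg N; rewrite /bdiff !fg. Qed.

Lemma iter_bdiff_cumsum k n r f : (0 < n)%N ->
  cumsum n (iter k (bdiff (r * n)) f) =1 iter k (bdiff (r * n.+1)) (cumsum n f).
Proof.
move=> n_gt0; elim: k => // k IH N.
by rewrite !iterS -bdiff_cumsum // (eq_bdiff _ IH).
Qed.

Lemma iter_bdiff_proport k n r f : (0 < n)%N ->
  proport n (iter k (bdiff (r * n)) f) =1 iter k (bdiff (r * n.+1)) (proport n f).
Proof.
move=> n_gt0; elim: k => // k IH N.
by rewrite !iterS -bdiff_proport // (eq_bdiff _ IH).
Qed.

Lemma iter_bdiffD k c f g :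
  iter k (bdiff c) (fun N => f N + g N) =1
  fun N => iter k (bdiff c) f N + iter k (bdiff c) g N.
Proof.
elim: k => // k IH N; rewrite !iterS {1}/bdiff !IH /bdiff.
by case: ifP => _; rewrite ?subr0 // opprD addrACA.
Qed.

Lemma iter_bdiff_scale k c f t : (0 < c)%N ->
  iter k (bdiff c) f (c * t)%N = iter k (bdiff 1) (fun u => f (c * u)%N) t.
Proof.
move=> c_gt0; elim: k t => // k IH [|t]; rewrite !iterS ?bdiff1_0 ?bdiff1_S -!IH.
  by rewrite /bdiff muln0 c_gt0 subr0.
by rewrite /bdiff mulnS ltnNge leq_addr addKn.
Qed.

(** Both prefix sums include their endpoints. This is right at the lower end
    [M / n = N / (n + 1) - r], which is to be removed, but keeps the upper end
    [M / n = N / (n + 1)], which [proport] takes away. *)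
Lemma window_sum n r f N : (0 < n)%N -> (0 < r)%N ->
  \sum_(M < N.+1 | (M * n.+1 < N * n)%N && (N * n < (M + r * n) * n.+1)%N) f M
  = bdiff (r * n.+1) (cumsum n f) N - proport n f N.
Proof.
move=> n_gt0 r_gt0; set A := ((n * N) %/ n.+1)%N.
have AN : (A <= N)%N by rewrite -ltnS ltn_divLR // mulSn mulnC; lia.
have cumsumE B : (B < N.+1)%N ->
  \sum_(M < B.+1) f M = \sum_(M < N.+1) if (M <= B)%N then f M else 0.
  by move=> BN; rewrite (big_ord_widen N.+1) // big_mkcond.
have leA M : (M <= A)%N = (M * n.+1 <= N * n)%N by rewrite leq_divRL // [(N * n)%N]mulnC.
have -> : bdiff (r * n.+1) (cumsum n f) N =
    \sum_(M < N.+1) ((if (M <= A)%N then f M else 0) - (if (M + r * n <= A)%N then f M else 0)).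
  rewrite sumrB /bdiff {1}/cumsum cumsumE //; congr (_ - _).
  have := leq_proport n r N; rewrite (gtn_eqF n_gt0) -/A /= => rA.
  case: ltnP => rN.
    have An : (A < r * n)%N by rewrite ltnNge rA -ltnNge.
    by rewrite big1 // => M _; rewrite ifF //; lia.
  rewrite /cumsum divn_mulB // -/A cumsumE; last by lia.
  by rewrite rN in rA; apply: eq_bigr => M _; congr (if _ then _ else _); lia.
have -> : proport n f N = \sum_(M < N.+1) if (M * n.+1 == N * n)%N then f M else 0.
  rewrite /proport -/A; case: ifP => dN.
    have eqA : (A * n.+1 = N * n)%N by rewrite /A divnK ?dvdn_mull // mulnC.
    rewrite (bigD1 (Ordinal (AN : (A < N.+1)%N))) //= eqA eqxx big1 ?addr0 // => M.
    rewrite -(inj_eq val_inj) /= => MA; rewrite ifF // -eqA eqn_mul2r /=.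
    exact: negPf.
  rewrite big1 // => M _; case: eqP => // eM; case/negP: dN.
  (* Equality of the fractions forces [n + 1] to divide [N], as [n] and [n + 1] are coprime. *)
  have : (n.+1 %| N * n)%N by rewrite -eM dvdn_mull.
  by rewrite Gauss_dvdl // coprimeSn.
rewrite -sumrB big_mkcond /=; apply: eq_bigr => M _.
rewrite !leA [(M * n.+1 <= _)%N]leq_eqVlt [(N * n < _)%N]ltnNge.
case: eqP => [eM|_] /=; last by case: ltnP => ? /=; case: leqP => ?; rewrite ?subr0 ?subrr //; lia.
rewrite -eM ltnn /= leq_mul2r /= ifF ?subr0 ?subrr //; lia.
Qed.

End Operators.

(* [chain_count r k N] counts the chains (x_1, ..., x_(k+1) = N) with 0 <= x_1 < r and
   0 < x_(i+1) / (i+1) - x_i / i < r. *)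
Fixpoint chain_count (r k : nat) (N : nat) : int :=
  if k is k'.+1 then
    \sum_(M < N.+1 | (M * k.+1 < N * k)%N && (N * k < (M + r * k) * k.+1)%N) chain_count r k' M
  else (N < r)%N%:R.

(* Solution of [marked_sumS]: the chains 0 <= x_1 / 1 <= ... <= x_n / n = N / n, weighted with a
   factor 1 + 'X for every equality. *)
Definition marked_sum (n N : nat) : {poly int} :=
  let q := (N %/ n)%N%:R in let s := (N %% n)%N in
  if s is s'.+1 then (q + 1) * (q + 1 + 'X) ^+ (n - s'.+2) * (q + 2 + 'X) ^+ s'
  else (q + 1 + 'X) ^+ n.-1.

(* The substitution of minus the inverse of the difference operator for 'X, multiplied by its
   n-th power. *)
Definition unmark (r n : nat) (F : nat -> {poly int}) (N : nat) : int :=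
  \sum_(j < n.+1) (-1) ^+ j * iter (n - j) (bdiff (r * n)) (fun M => (F M)`_j) N.

(** The sums telescope: raising [s] by one turns a factor [q + 1 + 'X] into [q + 2 + 'X], and
    passing to the next multiple of [n] turns the leading [q + 1] into [q + 2]. *)
Lemma sum_marked_sum n q s : (s < n)%N ->
  \sum_(M < (n * q + s).+1) marked_sum n M =
  (q%:R + 1) * (q%:R + 1 + 'X) ^+ (n - s.+1) * (q%:R + 2 + 'X) ^+ s.
Proof.
move=> sn; have n_gt0 : (0 < n)%N by lia.
have marked_sumE u v : (v < n)%N -> marked_sum n (n * u + v) =
    if v is v'.+1 then (u%:R + 1) * (u%:R + 1 + 'X) ^+ (n - v'.+2) * (u%:R + 2 + 'X) ^+ v'
    else (u%:R + 1 + 'X) ^+ n.-1.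
  move=> vn; rewrite /marked_sum mulnC divnMDl // modnMDl divn_small // modn_small //.
  by rewrite addn0.
have step u v : (v < n)%N ->
    \sum_(M < (n * u).+1) marked_sum n M = (u%:R + 1) * (u%:R + 1 + 'X) ^+ n.-1 ->
    \sum_(M < (n * u + v).+1) marked_sum n M =
    (u%:R + 1) * (u%:R + 1 + 'X) ^+ (n - v.+1) * (u%:R + 2 + 'X) ^+ v.
  move=> vn base; elim: v vn => [|v IH] vn.
    by rewrite addn0 base expr0 mulr1 subn1.
  rewrite addnS big_ord_recr IH 1?ltnW //= -addnS marked_sumE //.
  by rewrite -(subnSK vn) !exprS; ring.
apply: (step) => //; elim: q => [|q IH].
  have := marked_sumE 0%N 0%N n_gt0; rewrite muln0 addn0 big_ord1 => ->.
  by rewrite add0r mul1r.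
have nq : (n * q.+1 = (n * q + n.-1).+1)%N by rewrite mulnS; lia.
have := step q n.-1; rewrite -nq prednK // subnn => sum_pred.
have := marked_sumE q.+1 0%N n_gt0; rewrite addn0 => marked_sum_q.
rewrite big_ord_recr sum_pred ?prednK //= marked_sum_q.
have -> : q.+1%:R + 1 = q%:R + 2 :> {poly int} by rewrite -natr1; ring.
by ring.
Qed.

Lemma marked_sumS n N : (0 < n)%N ->
  marked_sum n.+1 N = cumsum n (marked_sum n) N + 'X * proport n (marked_sum n) N.
Proof.
move=> n_gt0; have sm := ltn_pmod N (ltn0Sn n).
(* The truncated predecessor also covers remainder 0. Only in that case does [proport] contribute,
   completing [q + 1] to one more factor [q + 1 + 'X]. *)
have eqA : ((n * N) %/ n.+1 = n * (N %/ n.+1) + (N %% n.+1).-1)%N.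
  rewrite {1}(divn_eq N n.+1) mulnDr mulnA divnMDl //; congr addn.
  move: sm; case: (_ %% _)%N => [|s] sm; first by rewrite muln0 div0n.
  have -> : (n * s.+1 = s * n.+1 + (n - s))%N by nia.
  by rewrite divnMDl // divn_small ?addn0 // ltnS leq_subr.
rewrite /cumsum /proport eqA sum_marked_sum; last by lia.
rewrite /dvdn /marked_sum; case: (N %% n.+1)%N sm => [|s] sm /=.
  rewrite addn0 modnMr mulKn //= subn1 mulr1.
  set y := _ + 'X; have -> : y ^+ n = y * y ^+ n.-1 by rewrite -exprS prednK.
  by rewrite /y; ring.
by rewrite mulr0 addr0 subSS.
Qed.

Lemma iter_bdiff_sum (V : zmodType) (I : Type) (rI : seq I) k c (F : I -> nat -> V) N :
  iter k (bdiff c) (fun M => \sum_(i <- rI) F i M) N = \sum_(i <- rI) iter k (bdiff c) (F i) N.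
Proof.
elim: rI => [|i rI IH].
  rewrite big_nil (@eq_iter_bdiff _ _ _ _ (fun=> 0)) => [|M]; last by rewrite big_nil.
  by elim: k N => // k IH N; rewrite iterS /bdiff !IH if_same subr0.
rewrite big_cons -IH -iter_bdiffD; apply: eq_iter_bdiff => M.
by rewrite big_cons.
Qed.

Lemma iter_bdiffZ k c (a : int) f N :
  iter k (bdiff c) (fun M => a * f M) N = a * iter k (bdiff c) f N.
Proof.
elim: k N => // k IH N; rewrite !iterS /bdiff !IH.
by case: ifP => _; rewrite ?subr0 // mulrBr.
Qed.

(** With [D] the difference, [unmark] is [D^n F(- 1 / D)]. One more power of [D] stays as [D] on the
    [cumsum] term and cancels ['X = - 1 / D] to -1 on the [proport] term; the differences pass
    through both operators. *)
Lemma unmarkS r n (F : nat -> {poly int}) N : (0 < n)%N -> (forall M, size (F M) <= n)%N ->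
  unmark r n.+1 (fun M => cumsum n F M + 'X * proport n F M) N =
  bdiff (r * n.+1) (cumsum n (unmark r n F)) N - proport n (unmark r n F) N.
Proof.
move=> n_gt0 sF.
have cumE : cumsum n (unmark r n F) =1 fun M => 
    \sum_(j < n.+1) (-1) ^+ j * iter (n - j) (bdiff (r * n.+1)) (cumsum n (fun M => (F M)`_j)) M.
  move=> M; rewrite {1}/cumsum exchange_big; apply: eq_bigr => j _.
  by rewrite -iter_bdiff_cumsum // /cumsum big_distrr.
have propE : proport n (unmark r n F) N =
    \sum_(j < n.+1) (-1) ^+ j * iter (n - j) (bdiff (r * n.+1)) (proport n (fun M => (F M)`_j)) N.
  rewrite (eq_bigr (fun j : 'I_n.+1 =>
    (-1) ^+ j * proport n (iter (n - j) (bdiff (r * n)) (fun M => (F M)`_j)) N)).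
    rewrite /proport; case: ifP => // _.
    by rewrite big1 // => j _; rewrite mulr0.
  by move=> j _; rewrite iter_bdiff_proport.
rewrite (eq_bdiff _ cumE) propE -[bdiff _ _ _]/(iter 1 (bdiff _) _ _) iter_bdiff_sum.
under eq_bigr do rewrite iter_bdiffZ.
have coefE j M : (cumsum n F M + 'X * proport n F M)`_j =
    cumsum n (fun M => (F M)`_j) M + (if j is j'.+1 then proport n (fun M => (F M)`_j') M else 0).
  rewrite coefD coefXM /cumsum coef_sum; congr (_ + _).
  by case: j => //= j; rewrite /proport; case: ifP => //; rewrite coef0.
pose D := bdiff (V := int) (r * n.+1).
rewrite {1}/unmark (eq_bigr (fun j : 'I_n.+2 =>
    (-1) ^+ j * iter (n.+1 - j) D (cumsum n (fun M => (F M)`_j)) N +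
    (-1) ^+ j * iter (n.+1 - j) D (fun M =>
      if j : nat is j'.+1 then proport n (fun M => (F M)`_j') M else 0) N)); last first.
  move=> j _; rewrite -mulrDr -iter_bdiffD; congr (_ * _).
  by apply: eq_iter_bdiff => M; exact: coefE.
rewrite big_split /=; congr (_ + _).
  (* The degree bound kills the top term, from which no difference could be factored out. *)
  have top0 : cumsum n (fun M => (F M)`_n.+1) N = 0.
    by rewrite /cumsum big1 // => M _; rewrite nth_default // leqW.
  rewrite big_ord_recr /= subnn /= top0 mulr0 addr0.
  by apply: eq_bigr => j _; rewrite subSn // -ltnS.
have D0 k M : iter k D (fun=> 0) M = 0.
  by elim: k M => // k IH M; rewrite iterS /D /bdiff -/D !IH if_same subr0.
rewrite big_ord_recl D0 mulr0 add0r -sumrN; apply: eq_bigr => j _.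
by rewrite /bump /= exprS !mulN1r subSS mulNr.
Qed.

Lemma size_marked_sum n N : (0 < n)%N -> (size (marked_sum n N) <= n)%N.
Proof.
move=> n_gt0; rewrite /marked_sum natr1 -natrD; have sn := ltn_pmod N n_gt0.
have sX (a m : nat) : (size ((a%:R + 'X : {poly int}) ^+ m) <= m.+1)%N.
  apply: leq_trans (size_poly_exp_leq _ _) _.
  by rewrite addrC -polyC_natr size_XaddC mul1n.
case: (N %% n)%N sn => [|s] sn; first by rewrite (leq_trans (sX _ _)) ?prednK.
have sC (a : nat) : (size (a%:R : {poly int}) <= 1)%N.
  by rewrite -polyC_natr size_polyC_leq1.
have := (sC (N %/ n).+1, sX (N %/ n).+1 (n - s.+2)%N, sX (N %/ n + 2)%N s).
move: (_.+1%:R) (_ ^+ (n - _)) (_ ^+ s) => p q u [[sp sq] su].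
have := size_polyMleq (p * q) u; have := size_polyMleq p q; lia.
Qed.

Lemma chain_count_marked_sum r k N : (0 < r)%N ->
  chain_count r k N = unmark r k.+1 (marked_sum k.+1) N.
Proof.
move=> r_gt0; elim: k N => [|k IH] N.
  (* One difference of step [r] of the constant 1 is the indicator of [N < r]. *)
  rewrite /unmark !big_ord_recl big_ord0 /= addr0 /bdiff.
  have f1 M : marked_sum 1 M = 1 by rewrite /marked_sum modn1.
  rewrite !f1 !coef1 muln1 /= mulr0 addr0 expr0 mul1r.
  by case: ltnP; rewrite ?subr0 ?subrr.
rewrite [LHS]/= window_sum // (_ : unmark _ _ _ N = unmark r k.+2
    (fun M => cumsum k.+1 (marked_sum k.+1) M + 'X * proport k.+1 (marked_sum k.+1) M) N).
  rewrite unmarkS // => [|M]; last exact: size_marked_sum.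
  by rewrite (eq_bdiff _ (eq_cumsum _ IH)) (eq_proport _ IH).
apply: eq_bigr => j _; congr (_ * _); apply: eq_iter_bdiff => M.
by rewrite marked_sumS.
Qed.

(** At multiples of [n + 1] the marked sum is the pure power [(r t + 1 + 'X)^n], expanded by the
    binomial theorem, and differences of step [r (n + 1)] become unit differences in [t]. *)
Lemma chain_count_final r n t : (0 < r)%N ->
  chain_count r n (r * n.+1 * t) =
  \sum_(j < n.+1) (-1) ^+ j *
    iter (n.+1 - j) (bdiff 1) (fun u => (r * u + 1)%:R ^+ (n - j) : int) t *+ 'C(n, j).
Proof.
move=> r_gt0; rewrite chain_count_marked_sum // /unmark.
have coefE j u : (marked_sum n.+1 (r * n.+1 * u))`_j = 'C(n, j)%:R * (r * u + 1)%:R ^+ (n - j).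
  rewrite /marked_sum mulnAC modnMl mulnK //= natr1 -addn1 exprDn coef_sum.
  under eq_bigr => i _.
    rewrite coefMn -natrX -polyC_natr coefCM coefXn natrX mulr_natr mulrb.
    over.
  have [jn|nj] := leqP j n.
    rewrite (bigD1 (Ordinal (jn : (j < n.+1)%N))) //= eqxx big1 ?addr0 ?mulr_natl // => i ij.
    by rewrite ifN ?mul0rn // eq_sym.
  rewrite bin_small // mul0r big1 // => i _; rewrite ifN ?mul0rn //.
  by rewrite gtn_eqF // (leq_ltn_trans _ nj) // -ltnS.
rewrite big_ord_recr /= subnn /= coefE bin_small // mul0r mulr0 addr0.
apply: eq_bigr => j _; rewrite -mulr_natl mulrCA; congr (_ * _).
rewrite iter_bdiff_scale ?muln_gt0 ?r_gt0 // -iter_bdiffZ.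
by apply: eq_iter_bdiff => u; rewrite coefE.
Qed.

(** * The open parallelepiped *)

Lemma sum_ord_tail0 (V : zmodType) (U U' : nat) (F : nat -> V) :
  (forall M, (minn U U' <= M)%N -> F M = 0) -> \sum_(M < U) F M = \sum_(M < U') F M.
Proof.
have le_sum A B : (A <= B)%N -> (forall M, (A <= M)%N -> F M = 0) ->
    \sum_(M < A) F M = \sum_(M < B) F M.
  move=> AB F0; rewrite (big_ord_widen B) // big_mkcond; apply: eq_bigr => M _.
  by case: ltnP => // /F0.
move=> F0; case: (leqP U U') => UU.
  by apply: le_sum => // M UM; apply: F0; lia.
by symmetry; apply: le_sum => [|M UM]; [exact: ltnW | apply: F0; lia].
Qed.

Lemma sum_ord_rev_le (V : nmodType) m j (F : nat -> V) : (j <= m)%N ->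
  \sum_(k < m.+1 | (m - k <= j)%N) F k = \sum_(i < j.+1) F (m - i)%N.
Proof.
move=> jm; rewrite (reindex_inj rev_ord_inj) /= (big_ord_widen m.+1 (fun i => F (m - i)%N)) //.
apply: eq_big => i; last by rewrite subSS.
by rewrite subSS subKn // -ltnS.
Qed.

(* A pair (x, t) stands for the fraction x / t. *)
Definition chain_step (p q : int * nat) : bool :=
  (p.1 * q.2%:Z < q.1 * p.2%:Z) && (q.1 * p.2%:Z < (p.1 + p.2%:Z) * q.2%:Z).

Section Simplex.

Variable t : seq nat.
Let m := size t.
Let tt := rcons t 1%N.

Lemma size_Pverts : size (Pverts t) = m.+1.
Proof. by rewrite size_map size_iota. Qed.

Lemma nth_Pverts k j : (k <= m)%N -> (j <= m)%N ->
  nth 0 (rcons (nth [::] (Pverts t) k) 1) j =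
  if (m - k <= j)%N then (nth 0%N tt j)%:Z else 0.
Proof.
move=> km jm; rewrite (nth_map 0%N) ?size_iota ?ltnS // nth_iota ?ltnS // add0n.
rewrite !nth_rcons size_map size_iota -/m; case: ltngtP jm => // [jm _|-> _].
  by rewrite (nth_map 0%N) ?size_iota // nth_iota // add0n.
by rewrite leq_subr.
Qed.

(** The ratios [x_j / t_j] are the partial sums of the [lam], read from the last vertex backwards;
    so each [lam] is a difference of consecutive ratios. *)
Lemma in_open_parE x : all (fun a => 0 < a)%N t -> size x = m.+1 ->
  in_open_par m (Pverts t) x <->
  path chain_step (0, 1%N) (zip x tt).
Proof.
move=> t_gt0 size_x.
have tt_gt0 j : (j <= m)%N -> (0 < nth 0 tt j)%N.
  move=> jm; rewrite nth_rcons -/m; case: (ltngtP j m) jm => // jm _.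
  by apply: (allP t_gt0); exact: mem_nth.
pose X j := nth 0 (0 :: x) j; pose T j := nth 0%N (1%N :: tt) j.
have T_gt0 j : (j <= m.+1)%N -> 0 < (T j)%:R :> Rdefinitions.R.
  by case: j => [|j] jm; rewrite ltr0n //; exact: tt_gt0.
have size_xt : size x = size tt by rewrite size_rcons.
have pathE : path chain_step (0, 1%N) (zip x tt) <->
    forall j, (j <= m)%N -> (X j)%:~R / (T j)%:R < (X j.+1)%:~R / (T j.+1)%:R :> Rdefinitions.R
       /\ (X j.+1)%:~R / (T j.+1)%:R < (X j)%:~R / (T j)%:R + 1 :> Rdefinitions.R.
  have stepE j : (j <= m)%N ->
      chain_step (X j, T j) (X j.+1, T j.+1) =
      ((X j)%:~R / (T j)%:R < (X j.+1)%:~R / (T j.+1)%:R :> Rdefinitions.R)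
       && ((X j.+1)%:~R / (T j.+1)%:R < (X j)%:~R / (T j)%:R + 1 :> Rdefinitions.R).
    move=> jm; have T0 := T_gt0 _ (leqW jm); have T1 := T_gt0 j.+1 jm.
    rewrite /chain_step /=.
    have -> : ((X j)%:~R / (T j)%:R < (X j.+1)%:~R / (T j.+1)%:R :> Rdefinitions.R) =
        (X j * (T j.+1)%:Z < X j.+1 * (T j)%:Z).
      by rewrite ltr_pdivrMr // mulrAC ltr_pdivlMr // -(ltr_int Rdefinitions.R) !intrM.
    rewrite ltr_pdivrMr // -(ltr_pM2r T0) mulrAC [(_ / _ + 1) * _]mulrDl divfK ?lt0r_neq0 // mul1r.
    by congr (_ && _); rewrite -(ltr_int Rdefinitions.R) !(intrM, intrD).
  have nthE j : (j <= m)%N -> nth (0, 0%N) (zip x tt) j = (X j.+1, T j.+1).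
    by move=> jm; rewrite nth_zip.
  have nthE' j : (j <= m)%N -> nth (0, 0%N) ((0, 1%N) :: zip x tt) j = (X j, T j).
    by case: j => // j jm; rewrite [LHS]/= nthE // ltnW.
  have size_zip_xt : size (zip x tt) = m.+1 by rewrite size_zip -size_xt minnn.
  split=> [/(pathP (0, 0%N)) H j jm | H].
    have := H j; rewrite size_zip_xt ltnS nthE // nthE' // => /(_ jm).
    by rewrite stepE // => /andP.
  apply/(pathP (0, 0%N)) => j; rewrite size_zip_xt ltnS => jm.
  by rewrite nthE // nthE' // stepE //; apply/andP/H.
have sumE (lam : nat -> Rdefinitions.R) j : (j <= m)%N ->
    \sum_(i < size (Pverts t)) lam i * (nth 0 (rcons (nth [::] (Pverts t) i) 1) j)%:~R
    = (\sum_(i < j.+1) lam (m - i)%N) * (T j.+1)%:R.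
  move=> jm; rewrite size_Pverts -sum_ord_rev_le // big_distrl [RHS]big_mkcond /=.
  apply: eq_bigr => k _; rewrite nth_Pverts // -1?ltnS //.
  by case: ifP; rewrite ?mulr0.
rewrite pathE; split=> [[lam [lam01 xE]] j jm | H].
  have YE i : (i <= m.+1)%N -> (X i)%:~R / (T i)%:R = \sum_(l < i) lam (m - l)%N.
    case: i => [_|i im]; first by rewrite big_ord0 mul0r.
    by rewrite [X _]/= xE // sumE // mulfK ?lt0r_neq0 ?T_gt0.
  rewrite !YE ?(leqW jm) // big_ord_recr /= ltrDl ltrD2l.
  by apply: lam01; rewrite size_Pverts ltnS leq_subr.
pose Y j : Rdefinitions.R := (X j)%:~R / (T j)%:R.
pose lam k := Y (m - k).+1 - Y (m - k)%N.
exists lam; split=> [k _ | j jm].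
  have [lt0 lt1] := H (m - k)%N (leq_subr _ _).
  by rewrite /lam subr_gt0 ltrBlDl.
rewrite sumE // (eq_bigr (fun i : 'I_j.+1 => Y i.+1 - Y i)) => [|i _]; last first.
  by rewrite /lam subKn //; have := ltn_ord i; lia.
rewrite -(big_mkord xpredT (fun i => Y i.+1 - Y i)) telescope_sumr //.
by rewrite {2}/Y mul0r subr0 divfK // lt0r_neq0 // T_gt0.
Qed.

(** For [i < m], exactly [i + 1] vertices have the entry [t_i] at [i]; for [i = m] the number of
    vertices suffices. *)
Lemma par_bound_ge i : (i <= m)%N -> (i.+1 * nth 0 tt i <= par_bound (Pverts t))%N.
Proof.
move=> im; rewrite /par_bound size_Pverts nth_rcons -/m.
case: ltngtP im => // [im _|-> _]; last by rewrite muln1 leq_addl.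
apply: (leq_trans _ (leq_addr _ _)).
rewrite (big_nth [::]) size_Pverts big_mkord.
have -> : (i.+1 * nth 0 t i = \sum_(k < m.+1 | m - k <= i) nth 0 t i)%N.
  by rewrite (sum_ord_rev_le (fun=> nth 0%N t i)) 1?ltnW // sum_nat_const card_ord.
rewrite big_mkcond; apply: leq_sum => k _; case: ifP => // ki.
rewrite (nth_map 0%N) ?size_iota // nth_iota // add0n big_map -/m.
by rewrite (bigD1_seq i) ?mem_iota ?iota_uniq //= ki leq_addr.
Qed.

End Simplex.

(** * Lattice-point sums as nested sums over chains *)

Fixpoint chain_poly (B x0 t0 : nat) (ts : seq nat) : {poly int} :=
  if ts is t1 :: ts' then
    \sum_(a < B.+1 | (x0 * t1 < a * t0)%N && (a * t0 < (x0 + t0) * t1)%N) chain_poly B a t1 ts'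
  else 'X^x0.

Lemma size_int_box B k x : x \in int_box B k -> size x = k.
Proof.
elim: k x => [|k IH] x; first by rewrite inE => /eqP ->.
by case/allpairsP => -[a s] [_ /IH sk ->] /=; rewrite sk.
Qed.

Lemma sum_int_box B x0 t0 ts : (0 < t0)%N -> all (fun a => 0 < a)%N ts ->
  \sum_(x <- int_box B (size ts) |
      path chain_step (x0%:Z, t0) (zip x ts)) 'X^(`|last x0%:Z x|%N)
  = chain_poly B x0 t0 ts.
Proof.
elim: ts x0 t0 => [|t1 ts IH] x0 t0 t0_gt0; first by rewrite big_cons big_nil addr0.
case/andP=> t1_gt0 ts_gt0; have -> : int_box B (size (t1 :: ts)) = [seq a :: s |
  a <- [seq i%:Z - B%:Z | i <- iota 0 (B + B).+1], s <- int_box B (size ts)] by [].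
rewrite big_mkcond big_allpairs_dep big_map.
rewrite -[iota _ _]/(index_iota 0 (B + B).+1) big_mkord -addnS.
rewrite big_split_ord /=.
(* The first [B] indices encode negative entries, excluded because ratios increase from
   [x0 / t0 >= 0]. *)
rewrite big1 ?add0r => [|i _]; last first.
  rewrite big1 // => s _; rewrite ifF //; apply/negbTE; rewrite negb_and /chain_step /=.
  have := ltn_ord i; move: (i : nat) => {}i iB.
  apply/orP; left; apply/negP => /andP[+ _]; nia.
rewrite [RHS]big_mkcond; apply: eq_bigr => a _.
have -> : (B + a)%:Z - B%:Z = a%:Z by lia.
have -> : chain_step (x0%:Z, t0) (a%:Z, t1) =
    (x0 * t1 < a * t0 < (x0 + t0) * t1)%N by rewrite /chain_step /= -PoszD -!PoszM !ltz_nat.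
rewrite -big_mkcond; case: ifP => st.
  by rewrite -IH //; apply: eq_bigl => s.
by rewrite big_pred0.
Qed.

Lemma dmt_chain_poly t : all (fun a => 0 < a)%N t ->
  dmt t = chain_poly (par_bound (Pverts t)) 0 1 (rcons t 1%N).
Proof.
move=> t_gt0; rewrite -sum_int_box // ?all_rcons // size_rcons /dmt /ellstar.
rewrite big_seq_cond [RHS]big_seq_cond; apply: eq_big => [x|x /andP[/size_int_box sx _]].
  case: (boolP (x \in int_box _ _)) => [/size_int_box sx|//]; rewrite !andTb.
  by apply/asboolP/idP; rewrite in_open_parE.
by rewrite -[size t]/(size t).+1.-1 -sx nth_last; case: x sx.
Qed.

(** Each step raises the ratio by less than 1, so from a ratio at most [k] the ratio after [i] steps
    stays below [k + i], within either cutoff. *)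
Lemma chain_poly_widen B B' k x0 t0 ts : (0 < t0)%N -> (B <= B')%N -> (x0 <= k * t0)%N ->
  (forall i, (i < size ts)%N -> ((k + i.+1) * nth 0 ts i <= B)%N) ->
  chain_poly B x0 t0 ts = chain_poly B' x0 t0 ts.
Proof.
move=> t0_gt0 BB'; elim: ts k x0 t0 t0_gt0 => // t1 ts IH k x0 t0 t0_gt0 x0k bnd.
have t1B : (k.+1 * t1 <= B)%N by have := bnd 0%N isT; rewrite addn1.
have ub a : (a * t0 < (x0 + t0) * t1)%N -> (a < k.+1 * t1)%N.
  move=> lt_a; rewrite -(ltn_pmul2r t0_gt0) (leq_trans lt_a) // mulnAC leq_mul2r.
  by rewrite mulSn addnC leq_add2l x0k orbT.
rewrite /= big_mkcond [RHS]big_mkcond /= -(@sum_ord_tail0 _ B.+1 B'.+1 (fun a =>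
  if (x0 * t1 < a * t0 < (x0 + t0) * t1)%N then chain_poly B' a t1 ts else 0)); last first.
  move=> M; rewrite (minn_idPl _) // => BM.
  by rewrite ifF //; apply/negP => /andP[_ /ub]; lia.
apply: eq_bigr => a _; case: ifP => // /andP[lt1 lt2]; apply: (IH k.+1).
- by rewrite lt0n; apply: contraTneq lt2 => ->; rewrite muln0.
- exact/ltnW/ub.
by move=> i si; have := bnd i.+1 si; rewrite addSnnS.
Qed.

Lemma chain_poly_scale B r ts : (0 < r)%N -> ts != [::] ->
  chain_poly B 0 1 ts = chain_poly B 0 r ts.
Proof.
move=> r_gt0; case: ts => // t1 ts _ /=; apply: eq_bigl => a.
by rewrite !mul0n !add0n muln1 mul1n [(r * t1)%N]mulnC ltn_pmul2r // muln_gt0 r_gt0 andbT.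
Qed.

(** The ratio starts below [r] and gains less than [r] at each of the [k] steps. *)
Lemma chain_count_eq0 r k N : (0 < r)%N -> (r * k.+1 * k.+1 <= N)%N -> chain_count r k N = 0.
Proof.
move=> r_gt0; elim: k N => [|k IH] N.
  by rewrite !muln1 /= ltnNge => ->.
move=> le_N; rewrite /= big1 // => M /andP[_ lt_N]; apply: IH.
have : (r * k.+2 * k.+1 * k.+2 < (M + r * k.+1) * k.+2)%N.
  by apply: leq_ltn_trans lt_N; rewrite mulnAC leq_mul2r.
rewrite ltn_pmul2r //.
have -> : (r * k.+2 * k.+1 = r * k.+1 * k.+1 + r * k.+1)%N by ring.
by rewrite ltn_add2r => /ltnW.
Qed.

(** Exchanging the sums moves the weights one step along the chains; with [t_i = i r] the moved
    weights are again values of [chain_count]. *)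
Lemma sum_chain_push B (c : nat -> int) (t0 t1 : nat) ts :
  \sum_(a < B.+1) c a *: chain_poly B a t0 (t1 :: ts) =
  \sum_(b < B.+1) (\sum_(a < B.+1 | (a * t1 < b * t0 < (a + t0) * t1)%N) c a) *:
    chain_poly B b t1 ts.
Proof.
under eq_bigr do rewrite /= scaler_sumr.
rewrite (exchange_big_dep predT) //=; apply: eq_bigr => b _.
by rewrite scaler_suml.
Qed.

Lemma sum_chain_count_step B r k ts : (0 < r)%N ->
  \sum_(a < B.+1) chain_count r k a *: chain_poly B a (k.+1 * r) ((k.+2 * r)%N :: ts) =
  \sum_(b < B.+1) chain_count r k.+1 b *: chain_poly B b (k.+2 * r) ts.
Proof.
move=> r_gt0; rewrite sum_chain_push; apply: eq_bigr => b _; congr (_ *: _) => /=.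
pose F M := if (M * k.+2 < b * k.+1 < (M + r * k.+1) * k.+2)%N then chain_count r k M else 0.
rewrite big_mkcond [RHS]big_mkcond /=.
rewrite -[RHS]/(\sum_(M < b.+1) F M) -(@sum_ord_tail0 _ B.+1 b.+1 F) => [|M].
  apply: eq_bigr => a _; rewrite /F [(r * _)%N]mulnC !mulnA !ltn_mul2r r_gt0 //.
rewrite (minn_idPr (ltn_ord b)) => bM; rewrite /F ifF //; apply/negP => /andP[]; nia.
Qed.

Lemma sum_chain_count_path B r k l : (0 < r)%N ->
  \sum_(a < B.+1) chain_count r k a *:
    chain_poly B a (k.+1 * r) (rcons [seq (i.+2 * r)%N | i <- iota k l] 1%N) =
  \sum_(b < B.+1) chain_count r (k + l) b *: chain_poly B b ((k + l).+1 * r) [:: 1%N].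
Proof.
move=> r_gt0; elim: l k => [|l IH] k; first by rewrite addn0.
by rewrite [iota _ _]/= map_cons rcons_cons sum_chain_count_step // IH addSnnS.
Qed.

(** The height [t / 1] equals [r (k + 2) t / ((k + 2) r)], so the last step is an ordinary step to
    that numerator. *)
Lemma coef_sum_chain_count B r k t : (0 < r)%N -> (r * k.+1 * k.+1 <= B)%N ->
  (\sum_(a < B.+1) chain_count r k a *: chain_poly B a (k.+1 * r) [:: 1%N])`_t =
  chain_count r k.+1 (r * k.+2 * t).
Proof.
move=> r_gt0 kB; rewrite sum_chain_push coef_sum.
have endE b : (chain_poly B b 1 [::])`_t = (t == b)%:R by rewrite coefXn.
have countE b : \sum_(a < B.+1 | (a * 1 < b * (k.+1 * r) < (a + k.+1 * r) * 1)%N) chain_count r k a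
    = chain_count r k.+1 (r * k.+2 * b).
  rewrite big_mkcond [RHS]/= [RHS]big_mkcond /=.
  have condE M : (M * k.+2 < r * k.+2 * b * k.+1 < (M + r * k.+1) * k.+2)%N =
      (M * 1 < b * (k.+1 * r) < (M + k.+1 * r) * 1)%N.
    have -> : (r * k.+2 * b * k.+1 = b * (k.+1 * r) * k.+2)%N by ring.
    by rewrite !ltn_mul2r /= !muln1 [(r * _)%N]mulnC.
  pose F M := if (M * 1 < b * (k.+1 * r) < (M + k.+1 * r) * 1)%N then chain_count r k M else 0.
  rewrite -[LHS]/(\sum_(M < B.+1) F M) (@sum_ord_tail0 _ B.+1 (r * k.+2 * b).+1 F) => [|M].
    by apply: eq_bigr => a _; rewrite /F condE.
  rewrite geq_min /F => /orP[BM|bM]; first by rewrite chain_count_eq0 ?if_same //; lia.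
  rewrite ifF //; apply/negP => /andP[+ _]; nia.
have tail0 : (B < t)%N -> chain_count r k.+1 (r * k.+2 * t) = 0.
  move=> Bt; apply: chain_count_eq0 => //; rewrite leq_mul2l; apply/orP; right; nia.
have [tB|Bt] := leqP t B; last first.
  rewrite tail0 // big1 // => b _; rewrite coefZ endE gtn_eqF ?mulr0 //.
  by apply: leq_ltn_trans Bt; rewrite -ltnS.
rewrite (bigD1 (Ordinal (tB : (t < B.+1)%N))) //= countE coefZ endE eqxx mulr1.
rewrite big1 ?addr0 // => b bt; rewrite coefZ endE.
by rewrite (_ : (t == b) = false) ?mulr0 //; apply/negbTE; rewrite eq_sym.
Qed.

Theorem theorem4p9 (n r : nat) (hn : (0 < n)%N) (hr : (0 < r)%N) :
  dmt [seq (i.+2 * r)%N | i <- iota 0 n.-1] +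
  dmt [seq (i.+1 * r)%N | i <- iota 0 n] = dnr n r.
Proof.
set s := map _ (iota 0 n.-1); set mu := map _ (iota 0 n).
have muE : mu = r :: s.
  rewrite /mu -(prednK hn) /= mul1n -[1%N]addn0 iotaDl -map_comp.
  by congr cons; apply: eq_map.
have s_gt0 : all (fun a => 0 < a)%N s.
  by apply/allP => a /mapP[i _ ->]; rewrite muln_gt0.
have mu_gt0 : all (fun a => 0 < a)%N mu by rewrite muE /= hr.
have boxE t : all (fun a => 0 < a)%N t -> forall B, (par_bound (Pverts t) <= B)%N ->
    dmt t = chain_poly B 0 1 (rcons t 1%N).
  move=> t_gt0 B tB; rewrite dmt_chain_poly //; apply: (@chain_poly_widen _ _ 0) => // i.
  by rewrite size_rcons ltnS => it; rewrite add0n par_bound_ge.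
(* The cutoff covers both boxes and, by the last summand, every nonzero value of
   [chain_count r n.-1]. *)
pose B := (par_bound (Pverts s) + par_bound (Pverts mu) + r * n * n)%N.
(* Chains for [mu] start with [0 < x_1 < r]; those for [s], started at [0 / r] instead of [0 / 1],
   supply [x_1 = 0]. *)
have weighted : dmt s + dmt mu =
    \sum_(a < B.+1) chain_count r 0 a *: chain_poly B a (1 * r) (rcons s 1%N).
  rewrite !(boxE _ _ B) //; try by rewrite /B; lia.
  rewrite (chain_poly_scale _ hr) //; last by case: (s).
  rewrite muE rcons_cons [chain_poly B 0 1 (r :: _)]/= big_mkcond big_ord_recl.
  rewrite [in LHS]/= add0r [RHS]big_ord_recl mul1n [chain_count _ _ _]/= hr scale1r.
  congr (_ + _); apply: eq_bigr => a _; rewrite [chain_count _ _ _]/= muln1.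
  by case: ltnP; rewrite ?scale1r ?scale0r.
apply/polyP => t; rewrite weighted sum_chain_count_path // add0n coef_sum_chain_count ?prednK //; last first.
  by rewrite /B leq_addl.
rewrite chain_count_final // dnr_binomial // coef_sum; apply: eq_bigr => k _.
have kn : (k <= n)%N by rewrite -ltnS.
have -> : (-1) ^+ k = ((-1) ^+ k)%:P :> {poly int} by rewrite polyC_exp polyCN.
by rewrite coefMn coefMC coef_exc_sum subSn // mulrC.
Qed.
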